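(* Let $h\in\mathbb{R}[x_1,\ldots,x_n]$ be hyperbolic with respect to $\mathbf{e}$, with hyperbolicity cone $\Lambda_{++}=\Lambda_{++}(\mathbf{e})$ and closed cone $\Lambda_+$. If $\mathbf{v}_1,\ldots,\mathbf{v}_m\in\Lambda_+$, then $h[\mathbf{v}_1,\ldots,\mathbf{v}_m]$ is hyperbolic (with respect to $(\mathbf{e},0,\ldots,0)$) with hyperbolicity cone containing $\Lambda_{++}\times(-\mathbb{R}_+^m)$, where $\mathbb{R}_+=[0,\infty)$.
   Context: A homogeneous polynomial $h$ of degree $d$ is hyperbolic with respect to $\mathbf{e}\in\mathbb{R}^n$ if $h(\mathbf{e})\neq0$ and for every $\mathbf{x}\in\mathbb{R}^n$, $t\mapsto h(t\mathbf{e}-\mathbf{x})$ has only real zeros; writing $h(t\mathbf{e}-\mathbf{x})=h(\mathbf{e})\prod_{j=1}^d(t-\lambda_j(\mathbf{x}))$ defines the eigenvalues. The (open) hyperbolicity cone is $\Lambda_{++}(\mathbf{e})=\{\mathbf{x}:\min_j\lambda_j(\mathbf{x})>0\}$ and $\Lambda_+(\mathbf{e})=\{\mathbf{x}:\min_j\lambda_j(\mathbf{x})\geq0\}$. For $\mathbf{v}\in\mathbb{R}^n$, $D_{\mathbf{v}}=\sum_k v_k\partial/\partial x_k$. For $\mathbf{v}_1,\ldots,\mathbf{v}_m\in\mathbb{R}^n$, $h[\mathbf{v}_1,\ldots,\mathbf{v}_m]\in\mathbb{R}[x_1,\ldots,x_n,y_1,\ldots,y_m]$ is defined by $h[\mathbf{v}_1,\ldots,\mathbf{v}_m]=\prod_{j=1}^m(1-y_jD_{\mathbf{v}_j})\,h(\mathbf{x})$.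 *)

(* Defs.v *)
From HB Require Import structures.
From mathcomp Require Import all_boot all_order all_algebra.
From mathcomp Require Import reals.
From mathcomp Require Import complex.
From mathcomp Require Import mpoly.
Set Implicit Arguments. Unset Strict Implicit. Unset Printing Implicit Defensive.
Import Order.TTheory GRing.Theory Num.Theory.
Local Open Scope ring_scope.

Section Hyperbolic.
Variable R : realType.

Definition restr_line (n : nat) (h : {mpoly R[n]}) (e x : 'I_n -> R) : {poly R} :=
  (map_mpoly (fun c : R => c%:P) h).@[fun i => 'X * (e i)%:P - (x i)%:P].

Definition hyperbolic (n : nat) (h : {mpoly R[n]}) (e : 'I_n -> R) : Prop :=
  [/\ exists d : nat, h \is d.-homog,
      h.@[e] != 0 &
      forall x : 'I_n -> R, forall z : R[i],
        root (map_poly (fun c : R => (c%:C)%C) (restr_line h e x)) z -> Im z = 0].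

(* The eigenvalues lambda_j(x) are exactly the zeros (with multiplicity) of
   t |-> h(te - x) (divided by h(e)).  Hence
   Lambda_++(e) = {x | min_j lambda_j(x) > 0} = {x | every zero is > 0}, and
   Lambda_+(e)  = {x | min_j lambda_j(x) >= 0} = {x | every zero is >= 0}. *)
Definition hcone_open (n : nat) (h : {mpoly R[n]}) (e : 'I_n -> R)
  (x : 'I_n -> R) : Prop :=
  forall t : R, root (restr_line h e x) t -> 0 < t.

Definition hcone_closed (n : nat) (h : {mpoly R[n]}) (e : 'I_n -> R)
  (x : 'I_n -> R) : Prop :=
  forall t : R, root (restr_line h e x) t -> 0 <= t.

(* Variables of R[x_1..x_n, y_1..y_m] are indexed by 'I_(n + m):
   x_k = 'X_(lshift m k), y_j = 'X_(rshift n j). *)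
Definition lift_x (n m : nat) (h : {mpoly R[n]}) : {mpoly R[n + m]} :=
  h \mPo [tuple 'X_(lshift m k) | k < n].

Definition Dx (n m : nat) (v : 'I_n -> R) (p : {mpoly R[n + m]}) : {mpoly R[n + m]} :=
  \sum_(k < n) v k *: mderiv (lshift m k) p.

(* h[v_1, ..., v_m] = prod_j (1 - y_j D_{v_j}) h  (the operators commute) *)
Definition hbr (n m : nat) (h : {mpoly R[n]}) (v : 'I_m -> 'I_n -> R)
  : {mpoly R[n + m]} :=
  foldr (fun j p => p - 'X_(rshift n j) * @Dx n m (v j) p) (@lift_x n m h) (enum 'I_m).

Definition joinv (n m : nat) (a : 'I_n -> R) (b : 'I_m -> R) : 'I_(n + m) -> R :=
  fun i => match split i with inl k => a k | inr j => b j end.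

End Hyperbolic.

(* Main.v *)
Require Import Defs.
From HB Require Import structures.
From mathcomp Require Import all_boot all_order all_algebra.
From mathcomp Require Import reals complex mpoly.
From mathcomp Require Import polyrcf classical_sets boolp ring lra.
Import Order.TTheory GRing.Theory Num.Theory.
Local Open Scope ring_scope.

(* Call C the cone of directions u with h(te + u) <> 0 for all t >= 0, that is Lambda_++.
   Garding's theorem is proved by moving zeros: if z_b is a segment in C^n and
   s |-> h(z_b + s v) has fixed degree and never vanishes for real s, then its zeros stay in
   the open lower half-plane as soon as they lie there at b = 0. Applied to
   z_b = i a e + b x this gives h(x + i u) <> 0 for u in C, and applied to
   z_b = i ((1 - b) e + b u) it gives C + C in C, hence C + Lambda_+ in C.
   By induction on the number of vectors, h[v_1, ..., v_j](z, c) <> 0 whenever Im z is in C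
   and Im c_i <= 0: on the line z + s v_j the operator 1 - c_j D_{v_j} is q |-> q - c_j q' at 0,
   where q has all its zeros in the lower half-plane. Hyperbolicity follows at once, and
   multiplying a real point (x, y) by i turns the non-vanishing on C x (-R_+^m) into a case of
   the same statement. *)

(** * Univariate complex polynomials and the upper half-plane: estimates uniform in the variable *)

Section UpperHalfPlane.
Context {R : realType}.
Local Notation C := R[i].
Local Notation "x %:C" := (real_complex R x) : ring_scope.
Local Notation normc z := (Normc.normc z : R).
Local Notation Re := (@complex.Re R).
Local Notation Im := (@complex.Im R).
Implicit Types (z w r : C) (p q : {poly C}).

Lemma normc_ge0 z : 0 <= normc z.
Proof. by case: z => a b; exact: sqrtr_ge0. Qed.

Lemma normc_ge_Im z : `|Im z| <= normc z.
Proof.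
case: z => a b /=; rewrite -sqrtr_sqr ler_sqrt ?lerDr ?sqr_ge0 //.
by rewrite addr_ge0 ?sqr_ge0.
Qed.

Lemma normc_real (x : R) : normc (x%:C) = `|x|.
Proof. by rewrite /= expr0n addr0 sqrtr_sqr. Qed.

Lemma le_normcB z w : normc z <= normc (z - w) + normc w.
Proof. by rewrite -{1}[z](subrK w) le_normcD. Qed.

Lemma normcX z k : normc (z ^+ k) = normc z ^+ k.
Proof.
elim: k => [|k IH]; first by rewrite !expr0 Normc.normc1.
by rewrite !exprS Normc.normcM IH.
Qed.

Lemma horner_lipschitz p (b : R) : exists2 K : R, 0 <= K &
  forall b', `|b' - b| <= 1 -> normc (p.[b'%:C] - p.[b%:C]) <= K * `|b' - b|.
Proof.
elim/poly_ind: p => [|p c [K K0 IH]].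
  by exists 0 => // b' _; rewrite !horner0 subrr Normc.normc0 mul0r.
exists (K * (`|b| + 1) + normc (p.[b%:C])) => [|b' bb'].
  by rewrite addr_ge0 ?normc_ge0 // mulr_ge0 // addr_ge0.
rewrite !hornerE.
have -> : p.[b'%:C] * b'%:C + c - (p.[b%:C] * b%:C + c) =
    (p.[b'%:C] - p.[b%:C]) * b'%:C + p.[b%:C] * (b' - b)%:C.
  by rewrite rmorphB /=; ring.
rewrite (le_trans (le_normcD _ _)) // !Normc.normcM !normc_real mulrDl lerD2r.
rewrite mulrAC; apply: ler_pM; rewrite ?normc_ge0 ?IH //.
by rewrite -(subrK b b') addrC (le_trans (ler_normD _ _)) // lerD2l.
Qed.

(** A one-parameter family of polynomials: the inner variable of [P] is the real parameter [b], the
    outer one is the variable that survives. *)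
Definition eval_coefs (P : {poly {poly C}}) (b : R) : {poly C} :=
  map_poly (horner_eval b%:C) P.

(** The weight [(1 + normc z) ^+ d] makes the bound uniform over the unbounded half-plane, so no
    compactness argument is needed later. *)
Lemma eval_coefs_lipschitz (P : {poly {poly C}}) d (b : R) :
  (size P <= d.+1)%N -> exists2 K : R, 0 <= K & forall b', `|b' - b| <= 1 ->
  forall z, normc ((eval_coefs P b').[z] - (eval_coefs P b).[z])
            <= K * `|b' - b| * (1 + normc z) ^+ d.
Proof.
move=> szP.
have sz b' : (size (eval_coefs P b') <= d.+1)%N.
  by rewrite (leq_trans _ szP) // size_poly.
suff [K K0 HK]: exists2 K : R, 0 <= K & forall b', `|b' - b| <= 1 -> forall z,
   normc (\sum_(i < d.+1) ((P`_i).[b'%:C] - (P`_i).[b%:C]) * z ^+ i)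
            <= K * `|b' - b| * (1 + normc z) ^+ d.
  exists K => // b' bb' z.
  rewrite (horner_coef_wide _ (sz b')) (horner_coef_wide _ (sz b)) -sumrB.
  under eq_bigr => i _ do rewrite !coef_map /= /horner_eval -mulrBl.
  exact: HK.
(* Only the number of summands is generalised; the exponent of the weight stays [d]. *)
elim: {-2}d.+1 (leqnn d.+1) => [_|k IH kd].
  exists 0 => // b' _ z.
  by rewrite big_ord0 Normc.normc0 !mul0r.
have [K K0 HK] := IH (ltnW kd).
have [L L0 HL] := horner_lipschitz (P`_k) b.
exists (K + L) => [|b' bb' z]; first exact: addr_ge0.
rewrite big_ord_recr /= (le_trans (le_normcD _ _)) // [(K + L) * _]mulrDl [leRHS]mulrDl.
apply: lerD; first exact: HK.
rewrite Normc.normcM normcX; apply: ler_pM; rewrite ?normc_ge0 ?HL //.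
  by rewrite exprn_ge0 ?normc_ge0.
have := normc_ge0 z; move: (normc z) => t t0.
apply: (@le_trans _ _ ((1 + t) ^+ k)).
  by rewrite lerXn2r ?nnegrE ?addr_ge0 // lerDr.
by rewrite ler_weXn2l // lerDl.
Qed.

(** From [normc (z - r) >= - Im r] one gets [1 + normc r <= (1 + normc r) / - Im r * normc (z - r)];
    the triangle inequality then bounds [1 + normc z]. *)
Lemma normc_sub_lower_half r : Im r < 0 ->
  exists2 k : R, 0 < k & forall z, 0 <= Im z -> k * (1 + normc z) <= normc (z - r).
Proof.
move=> r0; have := normc_ge0 r => rn.
have a0 : 0 < 1 + (1 + normc r) / - Im r.
  by rewrite addr_gt0 // divr_gt0 ?oppr_gt0 //; lra.
exists (1 + (1 + normc r) / - Im r)^-1 => [|z z0]; first by rewrite invr_gt0.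
rewrite ler_pdivrMl // mulrDl mul1r.
have H1 : - Im r <= normc (z - r).
  apply: le_trans (normc_ge_Im _); apply: le_trans (ler_norm _).
  by case: z r z0 {r0 rn a0} => [a b] [c e] /= ?; lra.
have H2 := le_normcB z r.
suff : 1 + normc r <= (1 + normc r) / - Im r * normc (z - r) by lra.
rewrite -mulrA ler_peMr //; first by lra.
by rewrite ler_pdivlMl ?oppr_gt0 // mulr1.
Qed.

(** The lower bound has the same growth as the weight in [eval_coefs_lipschitz], so it survives
    small changes of the parameter. *)
Lemma normc_prod_lower_half (rs : seq C) : {in rs, forall r, Im r < 0} ->
  exists2 k : R, 0 < k & forall z, 0 <= Im z ->
    k * (1 + normc z) ^+ size rs <= normc ((\prod_(r <- rs) ('X - r%:P)).[z]).
Proof.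
elim: rs => [_|r rs IH Hr].
  exists 1 => // z _; by rewrite big_nil hornerC Normc.normc1 mul1r.
have [k k0 Hk] : exists2 k : R, 0 < k & forall z, 0 <= Im z ->
    k * (1 + normc z) ^+ size rs <= normc ((\prod_(r <- rs) ('X - r%:P)).[z]).
  by apply: IH => s s_in; apply: Hr; rewrite inE s_in orbT.
have [l l0 Hl] := normc_sub_lower_half r (Hr r (mem_head _ _)).
exists (l * k) => [|z z0]; first exact: mulr_gt0.
rewrite big_cons hornerM hornerXsubC Normc.normcM /= exprS mulrACA.
have z1 : 0 <= 1 + normc z by rewrite addr_ge0 ?normc_ge0.
by apply: ler_pM; rewrite ?Hl ?Hk // mulr_ge0 ?exprn_ge0 // ltW.
Qed.

(** Each factor satisfies [normc (z - r) >= Im z - Im r >= Im z]. The bound does not depend on the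
    zeros, so one bound serves all nearby parameters. *)
Lemma normc_prod_ge_Im (rs : seq C) z : {in rs, forall r, Im r <= 0} ->
  0 <= Im z -> Im z ^+ size rs <= normc ((\prod_(r <- rs) ('X - r%:P)).[z]).
Proof.
move=> Hr z0; elim: rs Hr => [_|r rs IH Hr].
  by rewrite big_nil hornerC Normc.normc1.
rewrite big_cons hornerM hornerXsubC Normc.normcM /= exprS.
apply: ler_pM; rewrite ?exprn_ge0 //; last first.
  by apply: IH => s s_in; apply: Hr; rewrite inE s_in orbT.
have := Hr r (mem_head _ _).
move=> r0; apply: le_trans (normc_ge_Im (z - r)); apply: le_trans (ler_norm _).
by case: z r r0 {z0 IH Hr} => [a b] [c e] /=; lra.
Qed.

(** * Absence of zeros in the closed upper half-plane, and its invariance under homotopy *)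

Definition upper_free p := forall z, 0 <= Im z -> p.[z] != 0.

Lemma locally_constant_unit_interval (Q : R -> Prop) :
  (forall b, 0 <= b <= 1 -> exists2 del : R, 0 < del &
     forall b', 0 <= b' <= 1 -> `|b' - b| < del -> (Q b <-> Q b')) ->
  Q 0 -> Q 1.
Proof.
move=> loc Q0.
(* Connectedness of the unit interval through a supremum: [S] collects the [b] up to which [Q] holds
   throughout. *)
pose S : set R := [set b | 0 <= b <= 1 /\ forall c, 0 <= c <= b -> Q c]%classic.
have S0 : S 0.
  split=> [|c c0]; first lra.
  by have -> : c = 0 by lra.
have supS : has_sup S.
  by split; [exists 0 | exists 1 => b [? _]; lra].
have s0 : 0 <= sup S by exact: (sup_upper_bound supS).
have s1 : sup S <= 1.
  by apply: ge_sup; [exists 0 | move=> b [? _]; lra].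
have [del del0 Hdel] := loc (sup S) (introT andP (conj s0 s1)).
have [b [b01 Qb] bs] := sup_adherent del0 supS.
have bS : b <= sup S by exact: (sup_upper_bound supS).
have Qs : Q (sup S).
  apply/(Hdel b) => //; last by apply: Qb; lra.
  by rewrite ltr_norml; lra.
(* This [t] lies in [S], hence does not exceed [sup S]; so the minimum is attained by 1. *)
pose t := Num.min 1 (sup S + del / 2).
have [t1 t2] : t <= 1 /\ t <= sup S + del / 2.
  by rewrite /t; split; rewrite ge_min lexx ?orbT.
have ts : sup S <= t by rewrite /t le_min s1 /=; lra.
have St : S t.
  split; first lra.
  move=> c ct; case: (leP c b) => cb; first by apply: Qb; lra.
  by apply/(Hdel c) => //; rewrite ?ltr_norml; lra.
have tS : t <= sup S by exact: (sup_upper_bound supS).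
have E : 1 = t.
  apply/eqP; rewrite eq_le t1 andbT leNgt; apply/negP => tl1.
  have : sup S + del / 2 <= t.
    by move: tl1; rewrite /t minEle; case: ifP; rewrite ?ltxx.
  by lra.
by rewrite E; case: St => _; apply; lra.
Qed.

(** Both [upper_free] and its negation are open along the family, so neither can change on the
    interval. The constant leading coefficient keeps exactly [d] zeros, none escaping to
    infinity. *)
Lemma upper_free_homotopy (P : {poly {poly C}}) d (c : C) :
  (size P <= d.+1)%N -> P`_d = c%:P -> c != 0 ->
  (forall b s : R, 0 <= b <= 1 -> (eval_coefs P b).[s%:C] != 0) ->
  upper_free (eval_coefs P 0) -> upper_free (eval_coefs P 1).
Proof.
move=> szP Pd c0 nreal.
have c_gt0 : 0 < normc c.
  rewrite lt_neqAle normc_ge0 andbT eq_sym.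
  by apply/eqP => /Normc.eq0_normc /eqP; rewrite (negPf c0).
have coefd b : (eval_coefs P b)`_d = c by rewrite coef_map /= Pd /horner_eval hornerC.
have szb b : size (eval_coefs P b) = d.+1.
  apply/eqP; rewrite eqn_leq (leq_trans (size_poly _ _) szP) /=.
  by rewrite ltnNge; apply/negP => /leq_sizeP/(_ d (leqnn d))/eqP; rewrite coefd (negPf c0).
have fact b : exists2 rs : seq C, size rs = d &
    eval_coefs P b = c *: \prod_(r <- rs) ('X - r%:P).
  have [rs E] := closed_field_poly_normal (eval_coefs P b).
  have lc : lead_coef (eval_coefs P b) = c by rewrite lead_coefE szb coefd.
  exists rs; last by rewrite {1}E lc.
  by move: (szb b); rewrite E lc size_scale // size_prod_XsubC => -[].
apply: (locally_constant_unit_interval (fun b => upper_free (eval_coefs P b))) => b b01.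
have [K K0 HK] := eval_coefs_lipschitz P d b szP.
have [rs szrs Eb] := fact b.
have small e : 0 < e -> exists2 del : R, 0 < del & forall b', `|b' - b| < del ->
    forall z, normc ((eval_coefs P b').[z] - (eval_coefs P b).[z]) < e * (1 + normc z) ^+ d.
  (* The denominator is [K + 1] because [K] may be zero. *)
  move=> e0; exists (Num.min 1 (e / (K + 1))) => [|b' ].
    by rewrite lt_min ltr01 divr_gt0 //; lra.
  rewrite lt_min => /andP[/ltW b1 b2] z; apply: le_lt_trans (HK b' b1 z) _.
  rewrite ltr_pM2r; last by rewrite exprn_gt0 //; have := normc_ge0 z; lra.
  move: b2; rewrite ltr_pdivlMr; last lra.
  by have := normr_ge0 (b' - b); nra.
have [good|bad] := pselect (upper_free (eval_coefs P b)).
  (* If all zeros are in the open lower half-plane, the value at [z] has modulus at least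
     [normc c * k * (1 + normc z) ^+ d], which exceeds the perturbation. *)
  have [r rrs|k k0 Hk] := normc_prod_lower_half rs.
    rewrite ltNge; apply/negP => /good; rewrite Eb hornerZ.
    have /eqP -> : root (\prod_(r <- rs) ('X - r%:P)) r by rewrite root_prod_XsubC.
    by rewrite mulr0 eqxx.
  have [del del0 Hdel] := small _ (mulr_gt0 c_gt0 k0).
  exists del => // b' _ /Hdel Hb'; split=> // _ z z0.
  apply/negP => /eqP E; have := Hb' z.
  rewrite E sub0r normcN Eb hornerZ Normc.normcM -mulrA ltr_pM2l // ltNge -szrs.
  by rewrite Hk.
have [z [z0 /eqP Ez]] : exists z, 0 <= Im z /\ (eval_coefs P b).[z] == 0.
  apply: contrapT => H; apply: bad => z z0; apply/negP => E; apply: H.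
  by exists z.
(* Real zeros are excluded, so a bad zero lies strictly above the real axis. *)
have z1 : 0 < Im z.
  rewrite lt_neqAle z0 andbT; apply/negP => /eqP E.
  have := nreal b (Re z) b01.
  have -> : (Re z)%:C = z by case: z E {z0 Ez} => x y /= <-.
  by rewrite Ez eqxx.
have n0 : 0 < (1 + normc z) ^+ d by rewrite exprn_gt0 //; have := normc_ge0 z; lra.
(* The tolerance makes the nearby value at [z] smaller than [normc c * Im z ^+ d], which
   [normc_prod_ge_Im] forbids for an upper-free polynomial. *)
have [|del del0 Hdel] := small (normc c * Im z ^+ d / (1 + normc z) ^+ d).
  by rewrite divr_gt0 // mulr_gt0 // exprn_gt0.
exists del => // b' _ /Hdel/(_ z); rewrite Ez subr0 divfK; last exact: lt0r_neq0.
have [rs' szrs' Eb'] := fact b'.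
rewrite Eb' hornerZ Normc.normcM ltr_pM2l // => H; split=> [/bad//|good'].
exfalso; move: H; apply/negP; rewrite -leNgt -szrs' normc_prod_ge_Im // => r rrs.
rewrite leNgt; apply/negP => /ltW/good'; rewrite hornerZ.
have /eqP -> : root (\prod_(r <- rs') ('X - r%:P)) r by rewrite root_prod_XsubC.
by rewrite mulr0 eqxx.
Qed.

(** Here [w] is the logarithmic derivative at 0, the sum of the [- r^-1], each with imaginary part
    [Im r] divided by the squared modulus of [r]. The value 0 covers the empty product. *)
Lemma prod_XsubC_logderiv (rs : seq C) : {in rs, forall r, Im r < 0} ->
  let p := \prod_(r <- rs) ('X - r%:P) in
  exists2 w : C, (p^`()).[0] = w * p.[0] & w = 0 \/ Im w < 0.
Proof.
elim: rs => [_|r rs IH Hr] /=.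
  by exists 0; [rewrite big_nil derivC hornerC mul0r | left].
have [s s_in|w Ew Hw] := IH.
  by apply: Hr; rewrite inE s_in orbT.
have r0 := Hr r (mem_head _ _).
have rn0 : r != 0 by apply: contraTneq r0 => ->; rewrite ltxx.
exists (w - r^-1); last first.
  right; have : Im (w - r^-1) = Im w + Im r / (Re r ^+ 2 + Im r ^+ 2).
    by case: w r {Ew Hw Hr r0 rn0} => [a b] [c e] /=; ring.
  move=> ->.
  have : Im r / (Re r ^+ 2 + Im r ^+ 2) < 0.
    rewrite pmulr_llt0 // invr_gt0 ltr_wpDl ?sqr_ge0 //.
    by rewrite exprn_even_gt0 //= lt_eqF.
  by case: Hw => [->/=|]; lra.
rewrite big_cons derivM derivB derivX derivC subr0 !hornerE Ew.
move: (_.[0]) => P0 /=; by field.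
Qed.

(* [q - c q'] at 0 equals [q(0) (1 - c w)] with [w = sum_j 1 / (0 - r_j)] in the lower
   half-plane, where [r_j] are the zeros of [q]. *)
Lemma upper_free_sub_deriv p c : upper_free p -> Im c <= 0 ->
  p.[0] - c * (p^`()).[0] != 0.
Proof.
move=> good c0; have [rs E] := closed_field_poly_normal p.
set a := lead_coef p in E.
have p0 : p.[0] != 0 by apply: good.
have [r rrs|w Ew Hw] := prod_XsubC_logderiv rs.
  rewrite ltNge; apply/negP => /good; rewrite E hornerZ.
  have /eqP -> : root (\prod_(r <- rs) ('X - r%:P)) r by rewrite root_prod_XsubC.
  by rewrite mulr0 eqxx.
have -> : p.[0] - c * (p^`()).[0] = (1 - c * w) * p.[0].
  by rewrite E derivZ !hornerZ Ew; ring.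
rewrite mulf_neq0 // subr_eq0; apply/negP => /eqP E1.
case: Hw => [w0|wI]; first by move: E1; rewrite w0 mulr0 => /eqP; rewrite oner_eq0.
have wn0 : w != 0 by apply: contraTneq wI => ->; rewrite ltxx.
(* Inversion sends the lower half-plane to the upper one, which contradicts [Im c <= 0]. *)
have : c = w^-1 by rewrite -[LHS](mulfK wn0) -E1 mul1r.
move=> Ec; move: c0; rewrite Ec.
have -> : Im w^-1 = - Im w / (Re w ^+ 2 + Im w ^+ 2).
  by case: w {Ew wI E1 wn0 Ec} => [x y] /=; ring.
rewrite leNgt divr_gt0 ?oppr_gt0 // ltr_wpDl ?sqr_ge0 //.
by rewrite exprn_even_gt0 //= lt_eqF.
Qed.

End UpperHalfPlane.

(** * Substitution into multivariate polynomials: homogeneity, restriction to lines, chain rule *)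

Section Substitution.
Context {n : nat}.

Lemma rmorph_mmap (S T U : comNzRingType) (f : S -> T) (g : {rmorphism T -> U})
    (w : 'I_n -> T) (p : {mpoly S[n]}) :
  g (mmap f w p) = mmap (g \o f) (g \o w) p.
Proof.
rewrite /mmap rmorph_sum; apply: eq_bigr => m _.
rewrite rmorphM /mmap1 rmorph_prod; congr (_ * _).
by apply: eq_bigr => i _; rewrite rmorphXn.
Qed.

Lemma eq_mmap (S T : comNzRingType) (f f' : S -> T) (w w' : 'I_n -> T)
    (p : {mpoly S[n]}) : f =1 f' -> w =1 w' -> mmap f w p = mmap f' w' p.
Proof.
move=> ff' ww'; apply: eq_bigr => m _; rewrite ff'; congr (_ * _).
exact: mmap1_eq.
Qed.

Lemma meval_map_mpoly (S T : comNzRingType) (f : {rmorphism S -> T})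
    (w : 'I_n -> T) (p : {mpoly S[n]}) : (map_mpoly f p).@[w] = mmap f w p.
Proof.
rewrite /map_mpoly rmorph_mmap; apply: eq_mmap => i /=.
  by rewrite mevalC.
by rewrite mevalXU.
Qed.

Lemma mmap_homog (S T : comNzRingType) (f : S -> T) (w : 'I_n -> T)
    (p : {mpoly S[n]}) d (s : T) : p \is d.-homog ->
  mmap f (fun i => s * w i) p = s ^+ d * mmap f w p.
Proof.
move=> /dhomogP hp; rewrite /mmap mulr_sumr big_seq [RHS]big_seq.
apply: eq_bigr => m /hp <-; rewrite mulrCA; congr (_ * _).
rewrite /mmap1 (eq_bigr _ (fun i _ => exprMn _ _ _)) big_split /=; congr (_ * _).
by rewrite mdegE prodrXr.
Qed.

(** The top coefficient is read at the nominal degree, since some [u i] may vanish and lower the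
    actual size. *)
Lemma size_coef_prod_line (T : comNzRingType) (I : Type) (rs : seq I)
    (w u : I -> T) (k : I -> nat) :
  let q := \prod_(i <- rs) ((w i)%:P + 'X * (u i)%:P) ^+ k i in
  (size q <= (\sum_(i <- rs) k i).+1)%N /\
  q`_(\sum_(i <- rs) k i) = \prod_(i <- rs) u i ^+ k i.
Proof.
have coefM (p q : {poly T}) a b : (size p <= a.+1)%N -> (size q <= b.+1)%N ->
    (size (p * q)%R <= (a + b).+1)%N /\ (p * q)`_(a + b) = p`_a * q`_b.
  move=> pa qb; split.
    rewrite (leq_trans (size_polyMleq _ _)) //.
    by have := leq_add pa qb; rewrite addSn addnS; case: (size p + size q)%N.
  have lt_ab : (a < (a + b).+1)%N by rewrite ltnS leq_addr.
  rewrite coefM (bigD1 (Ordinal lt_ab)) //= addKn big1 ?addr0 // => i.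
  rewrite -val_eqE /= neq_ltn => /orP[ia|ai].
    rewrite [q`_ _]nth_default ?mulr0 // (leq_trans qb) //.
    by rewrite ltn_subRL ltn_add2r.
  by rewrite [p`_ _]nth_default ?mul0r // (leq_trans pa).
have coefX i l : (size (((w i)%:P + 'X * (u i)%:P) ^+ l)%R <= l.+1)%N /\
    (((w i)%:P + 'X * (u i)%:P) ^+ l)`_l = u i ^+ l.
  elim: l => [|l [IH1 IH2]]; first by rewrite !expr0 size_poly1 coef1.
  have s1 : (size ((w i)%:P + 'X * (u i)%:P)%R <= 2)%N.
    by rewrite addrC -commr_polyX size_MXaddC; case: ifP => //; rewrite ltnS size_polyC leq_b1.
  have [IH3 IH4] := coefM _ _ _ _ s1 IH1.
  rewrite !exprS; split=> //; rewrite IH4 IH2; congr (_ * _).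
  by rewrite coefD coefC coefXM coefC /= add0r.
elim: rs => [|i rs [IH1 IH2]] /=; first by rewrite !big_nil size_poly1 coef1.
have [s1 c1] := coefX i (k i); have [s2 c2] := coefM _ _ _ _ s1 IH1.
by rewrite !big_cons; split=> //; rewrite c2 c1 IH2.
Qed.

Lemma size_mmap_line (S T : comNzRingType) (f : {rmorphism S -> T}) (w u : 'I_n -> T)
    (p : {mpoly S[n]}) d : p \is d.-homog ->
  (size (mmap (polyC \o f) (fun i => (w i)%:P + 'X * (u i)%:P)%R p) <= d.+1)%N.
Proof.
move=> /dhomogP hp; rewrite /mmap big_seq.
apply: (leq_trans (size_sum _ _ _)); apply/bigmax_leqP_seq => m /hp md _ /=.
have := size_coef_prod_line T _ (index_enum 'I_n) w u m => -[s1 _].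
rewrite mul_polyC (leq_trans (size_scale_leq _ _)) //.
by rewrite -mdegE in s1; rewrite -md.
Qed.

(** The top coefficient on a line depends only on its direction [u], so translating the base point
    leaves it fixed. *)
Lemma coef_mmap_line (S T : comNzRingType) (f : {rmorphism S -> T}) (w u : 'I_n -> T)
    (p : {mpoly S[n]}) d : p \is d.-homog ->
  (mmap (polyC \o f) (fun i => (w i)%:P + 'X * (u i)%:P) p)`_d = mmap f u p.
Proof.
move=> /dhomogP hp; rewrite /mmap big_seq [RHS]big_seq coef_sum.
apply: eq_bigr => m /hp md /=; rewrite coefCM; congr (_ * _).
have := size_coef_prod_line T _ (index_enum 'I_n) w u m => -[_].
by rewrite -mdegE md.
Qed.

(** The chain rule is stable under products and linear combinations, so it suffices to check it on 1
    and on the variables. *)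
Lemma deriv_mmap (S T : comNzRingType) (f : {rmorphism S -> T})
    (w : 'I_n -> {poly T}) (p : {mpoly S[n]}) :
  (mmap (polyC \o f) w p)^`() =
  \sum_(i < n) mmap (polyC \o f) w (mderiv i p) * (w i)^`().
Proof.
pose chain (p : {mpoly S[n]}) := (mmap (polyC \o f) w p)^`() =
  \sum_(i < n) mmap (polyC \o f) w (mderiv i p) * (w i)^`().
have chainM q r : chain q -> chain r -> chain (q * r).
  rewrite /chain => Hq Hr; rewrite rmorphM derivM Hq Hr mulr_suml mulr_sumr -big_split.
  by apply: eq_bigr => i _; rewrite mderivM rmorphD !rmorphM /=; ring.
have chain1 : chain 1.
  rewrite /chain rmorph1 derivC big1 // => i _.
  by rewrite -[1]/(1%:MP) mderivC rmorph0 mul0r.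
have chainXi i : chain 'X_i.
  rewrite /chain mmapX mmap1U (bigD1 i) //= mderivX mnm1E eqxx scale1r.
  have -> : (U_(i) - U_(i) = 0)%MM by apply/mnmP => j; rewrite mnmBE mnm0E subnn.
  rewrite mpolyX0 rmorph1 mul1r big1 ?addr0 // => j ji.
  by rewrite mderivX mnm1E eq_sym (negPf ji) scale0r rmorph0 mul0r.
have chainX m : chain 'X_[m].
  rewrite mpolyXE_id; elim/big_ind: _ => // i _.
  by elim: (m i) => [|k IH]; rewrite ?expr0 // exprS; apply: chainM.
elim/mpolyind: p => [|c m p _ _ IH]; rewrite -/(chain _).
  by rewrite /chain rmorph0 deriv0 big1 // => i _; rewrite mderiv0 rmorph0 mul0r.
rewrite /chain rmorphD derivD IH /= mmapZ /= mul_polyC derivZ (chainX m).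
rewrite scaler_sumr -big_split; apply: eq_bigr => i _ /=.
by rewrite mderivD mderivZ rmorphD /= mmapZ /= -mul_polyC; ring.
Qed.

End Substitution.

(** * The hyperbolicity cone as a non-vanishing set, and its elementary properties *)

Section Garding.
Context {R : realType} {n : nat} (h : {mpoly R[n]}) (e : 'I_n -> R).
Local Notation C := R[i].
Local Notation "x %:C" := (real_complex R x) : ring_scope.
Local Notation Im := (@complex.Im R).
Local Notation ii := (Complex 0 1 : C).
Local Notation hC w := (mmap (real_complex R) w h).

Lemma restr_line_horner (x : 'I_n -> R) t :
  (restr_line h e x).[t] = h.@[fun i => t * e i - x i].
Proof.
rewrite /restr_line meval_map_mpoly -/(horner_eval t _) rmorph_mmap.
by apply: eq_mmap => i; rewrite /= /horner_eval !hornerE.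
Qed.

Lemma restr_line_complex_horner (x : 'I_n -> R) (z : C) :
  (map_poly (real_complex R) (restr_line h e x)).[z] =
  hC (fun i => z * (e i)%:C - (x i)%:C).
Proof.
rewrite /restr_line meval_map_mpoly rmorph_mmap -/(horner_eval z _) rmorph_mmap.
apply: eq_mmap => i /=; first by rewrite map_polyC /horner_eval hornerC.
by rewrite rmorphB rmorphM /= map_polyX !map_polyC /horner_eval !hornerE.
Qed.

Lemma mmap_real (x : 'I_n -> R) : hC (fun i => (x i)%:C) = (h.@[x])%:C.
Proof. by rewrite /meval rmorph_mmap. Qed.

Definition in_cone (u : 'I_n -> R) :=
  forall t, 0 <= t -> h.@[fun i => t * e i + u i] != 0.

Context (d : nat) (h_homog : h \is d.-homog).

Lemma mmapZr (s : C) w : hC (fun i => s * w i) = s ^+ d * hC w.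
Proof. exact: mmap_homog. Qed.

Lemma mevalZr (s : R) w : h.@[fun i => s * w i] = s ^+ d * h.@[w].
Proof. exact: mmap_homog. Qed.

Lemma root_restr_line (u : 'I_n -> R) t :
  root (restr_line h e u) t = (h.@[fun i => - t * e i + u i] == 0).
Proof.
rewrite rootE restr_line_horner.
rewrite (meval_eq _ (_ : _ =1 fun i => -1 * (- t * e i + u i))); last first.
  by move=> i; ring.
by rewrite mevalZr mulf_eq0 expf_eq0 oppr_eq0 oner_eq0 andbF.
Qed.

Lemma hcone_openP u : hcone_open h e u <-> in_cone u.
Proof.
split=> [H t t0|H t].
  apply/negP; rewrite -[t]opprK -root_restr_line => /H; lra.
rewrite root_restr_line ltNge => /eqP E; apply/negP => t0.
by have := H (- t); rewrite E eqxx oppr_ge0 => /(_ t0).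
Qed.

Lemma hcone_closedP u : hcone_closed h e u <->
  (forall t, 0 < t -> h.@[fun i => t * e i + u i] != 0).
Proof.
split=> [H t t0|H t].
  apply/negP; rewrite -[t]opprK -root_restr_line => /H; lra.
rewrite root_restr_line leNgt => /eqP E; apply/negP => t0.
by have := H (- t); rewrite E eqxx oppr_gt0 => /(_ t0).
Qed.

Context (he : h.@[e] != 0).
Context (h_real_rooted : forall (x : 'I_n -> R) (z : C), Im z != 0 ->
  hC (fun i => (x i)%:C + z * (e i)%:C) != 0).

Lemma in_cone_addl u a : in_cone u -> 0 <= a -> in_cone (fun i => a * e i + u i).
Proof.
move=> Hu a0 t t0; rewrite (meval_eq _ (_ : _ =1 fun i => (t + a) * e i + u i)).
  by apply: Hu; lra.
by move=> i; ring.
Qed.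

Lemma in_cone_meval u : in_cone u -> h.@[u] != 0.
Proof.
move=> /(_ 0 (lexx _)).
by rewrite (meval_eq _ (_ : _ =1 u)) // => i; rewrite mul0r add0r.
Qed.

Lemma in_cone_e a : 0 < a -> in_cone (fun i => a * e i).
Proof.
move=> a0 t t0; rewrite (meval_eq _ (_ : _ =1 fun i => (t + a) * e i)).
  by rewrite mevalZr mulf_neq0 // expf_neq0 // gt_eqF //; lra.
by move=> i; ring.
Qed.

(** For [b > 0], dividing by [b] turns the point into [u] plus a nonnegative multiple of [e]. *)
Lemma in_cone_segment u b : in_cone u -> 0 <= b <= 1 ->
  in_cone (fun i => (1 - b) * e i + b * u i).
Proof.
move=> Hu b01; have [->|b0] := eqVneq b 0.
  move=> t t0; rewrite (meval_eq _ (_ : _ =1 fun i => t * e i + 1 * e i)).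
    exact: in_cone_e.
  by move=> i; ring.
have b_gt0 : 0 < b by rewrite lt_neqAle eq_sym b0; lra.
move=> t t0.
rewrite (meval_eq _ (_ : _ =1 fun i => b * ((t + (1 - b)) / b * e i + u i))).
  rewrite mevalZr mulf_neq0 ?expf_neq0 //; apply: Hu.
  by rewrite divr_ge0 //; lra.
by move=> i; field.
Qed.

Lemma in_cone_subl u : in_cone u ->
  exists2 eps : R, 0 < eps & in_cone (fun i => u i - eps * e i).
Proof.
move=> Hu; pose p := restr_line h e u.
have p0 : 0 < `|p.[0]|.
  by rewrite normr_gt0 -rootE root_restr_line oppr0 Hu.
have [del del0 Hdel] := poly_cont 0 p p0.
exists (del / 2) => [|t t0]; first lra.
rewrite (meval_eq _ (_ : _ =1 fun i => - (del / 2 - t) * e i + u i)).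
  (* For [t >= del / 2] the point is [u] plus a nonnegative multiple of [e]; for smaller [t],
     continuity of [p] at 0 applies. *)
  rewrite -root_restr_line rootE -/p; case: (ltP t (del / 2)) => Ht; last first.
    by rewrite -rootE root_restr_line Hu //; lra.
  have := Hdel (del / 2 - t); rewrite subr0 ger0_norm; last lra.
  have lt_del : del / 2 - t < del by lra.
  by move=> /(_ lt_del) H; apply/negP => /eqP E; rewrite E sub0r normrN ltxx in H.
by move=> i; ring.
Qed.

(** This is the start of both homotopies. Dividing by [s] leaves [v + t e] with [t = a i / s]: a
    non-real [t] is handled by real-rootedness, and a real [t] is nonnegative because
    [a = t * Im s]. *)
Lemma mmap_e_cone_neq0 v a s : in_cone v -> 0 < a -> 0 <= Im s ->
  hC (fun i => a%:C * ii * (e i)%:C + s * (v i)%:C) != 0.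
Proof.
move=> Hv a0 s0; have [->|sn0] := eqVneq s 0.
  rewrite (eq_mmap _ _ _ (real_complex R) _ (fun i => a%:C * ii * (e i)%:C)) //; last first.
    by move=> i; ring.
  rewrite mmapZr mmap_real mulf_neq0 ?expf_neq0 //.
    rewrite mulf_neq0 ?eq_complex /= ?oner_eq0 ?andbF //.
    by rewrite gt_eqF.
  by rewrite eq_complex /= negb_and he.
pose t := a%:C * ii / s.
rewrite (eq_mmap _ _ _ (real_complex R) _ (fun i => s * ((v i)%:C + t * (e i)%:C))) //; last first.
  by move=> i; rewrite /t; field.
rewrite mmapZr mulf_neq0 ?expf_neq0 //.
have [tI|] := eqVneq (Im t) 0; last exact: h_real_rooted.
have Et : t = (complex.Re t)%:C by case: t tI => x y /= ->.
have Es : a%:C * ii = (complex.Re t)%:C * s by rewrite -Et /t; field.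
rewrite Et; set r := complex.Re t in Es *.
have Ea : a = r * Im s.
  by move: Es; case: (s) => x y [_ /=]; rewrite !(mul0r, mulr1, addr0, mulr0) => ->; ring.
rewrite (eq_mmap _ _ _ (real_complex R) _ (fun i => (r * e i + v i)%:C)) //; last first.
  by move=> i; rewrite rmorphD rmorphM /= addrC.
rewrite mmap_real eq_complex /= negb_and Hv //.
by rewrite leNgt; apply/negP => r0; nra.
Qed.

(** * Moving zeros along segments: non-vanishing on tubes and convexity of the cone *)

Lemma segment_homotopy (z0 z1 : 'I_n -> C) (v : 'I_n -> R) : h.@[v] != 0 ->
  (forall b s : R, 0 <= b <= 1 ->
     hC (fun i => (1 - b)%:C * z0 i + b%:C * z1 i + s%:C * (v i)%:C) != 0) ->
  (forall s, 0 <= Im s -> hC (fun i => z0 i + s * (v i)%:C) != 0) ->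
  forall s, 0 <= Im s -> hC (fun i => z1 i + s * (v i)%:C) != 0.
Proof.
move=> hv Hreal H0 s s0.
pose z (i : 'I_n) : {poly C} := (z0 i)%:P + 'X * (z1 i - z0 i)%:P.
pose u (i : 'I_n) : {poly C} := ((v i)%:C)%:P.
(* The outer variable is [s], the inner one [b]; the top coefficient in [s] is [h(v)], free of
   [b]. *)
pose P : {poly {poly C}} :=
  mmap (polyC \o (polyC \o real_complex R)) (fun i => (z i)%:P + 'X * (u i)%:P) h.
have PE b (t : C) : (eval_coefs P b).[t] =
    hC (fun i => (1 - b)%:C * z0 i + b%:C * z1 i + t * (v i)%:C).
  rewrite /eval_coefs /P rmorph_mmap -/(horner_eval t _) rmorph_mmap.
  apply: eq_mmap => i /=.
    by rewrite map_polyC /= /horner_eval !hornerE.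
  rewrite rmorphD rmorphM /= map_polyX !map_polyC /= /horner_eval /z /u !hornerE.
  by rewrite rmorphB /= rmorph1; ring.
have Pd : P`_d = ((h.@[v])%:C)%:P.
  by rewrite /P coef_mmap_line // -mmap_real rmorph_mmap.
have vn0 : (h.@[v])%:C != 0 by rewrite eq_complex /= negb_and hv.
have := upper_free_homotopy P d (h.@[v])%:C (size_mmap_line _ _ _ _ _ _ _ h_homog) Pd vn0.
have free0 : upper_free (eval_coefs P 0).
  move=> t t0; rewrite PE.
  rewrite (eq_mmap _ _ _ (real_complex R) _ (fun i => z0 i + t * (v i)%:C)) ?H0 // => i.
  by rewrite subr0 rmorph1 rmorph0; ring.
move=> /(_ _ free0 s s0); rewrite PE.
rewrite (eq_mmap _ _ _ (real_complex R) _ (fun i => z1 i + s * (v i)%:C)) => [| |i] //.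
  by apply=> b r b01; rewrite PE Hreal.
by rewrite subrr rmorph1 rmorph0; ring.
Qed.

Lemma mmap_shift_cone_neq0 (x : 'I_n -> R) v a s : in_cone v -> 0 < a -> 0 <= Im s ->
  hC (fun i => a%:C * ii * (e i)%:C + (x i)%:C + s * (v i)%:C) != 0.
Proof.
move=> Hv a0; apply: (segment_homotopy (fun i => a%:C * ii * (e i)%:C)).
- exact: in_cone_meval.
- move=> b t _.
  rewrite (eq_mmap _ _ _ (real_complex R) _
    (fun i => (b * x i + t * v i)%:C + a%:C * ii * (e i)%:C)) => [| |i] //.
    apply: h_real_rooted.
    by rewrite /= !(mul0r, mulr0, mulr1, addr0, subr0) gt_eqF.
  by rewrite rmorphB rmorphD !rmorphM /= rmorph1; ring.
- by move=> t t0; apply: mmap_e_cone_neq0.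
Qed.

(** By openness [u = a e + (u - a e)] with [u - a e] still in the cone; the shifted statement is
    then used at [s = i]. *)
Lemma mmap_tube_neq0 (x u : 'I_n -> R) : in_cone u ->
  hC (fun i => (x i)%:C + ii * (u i)%:C) != 0.
Proof.
move=> /in_cone_subl [a a0 Hu].
rewrite (eq_mmap _ _ _ (real_complex R) _
  (fun i => a%:C * ii * (e i)%:C + (x i)%:C + ii * (u i - a * e i)%:C)) => [| |i] //.
  by apply: mmap_shift_cone_neq0.
by rewrite rmorphB rmorphM /=; ring.
Qed.

Lemma in_coneD u v : in_cone u -> in_cone v -> in_cone (fun i => u i + v i).
Proof.
move=> Hu Hv; suff HD u' : in_cone u' -> h.@[fun i => u' i + v i] != 0.
  move=> t t0; rewrite (meval_eq _ (_ : _ =1 fun i => t * e i + u i + v i)).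
    exact/HD/in_cone_addl.
  by move=> i; ring.
move=> Hu'.
suff : hC (fun i => ii * (u' i + v i)%:C) != 0.
  by rewrite mmapZr mmap_real; apply: contraNneq => ->; rewrite rmorph0 mulr0.
rewrite (eq_mmap _ _ _ (real_complex R) _
  (fun i => ii * (u' i)%:C + ii * (v i)%:C)) => [| |i] //; last first.
  by rewrite rmorphD mulrDr.
(* The homotopy runs from [i e] to [i u'] in direction [v] and is read at [s = i]. For real [s] the
   imaginary part stays on the segment from [e] to [u'], inside the cone. *)
apply: (segment_homotopy (fun i => ii * (e i)%:C)) => [|b s b01|s s0|]; last exact: ler01.
- exact: in_cone_meval.
- rewrite (eq_mmap _ _ _ (real_complex R) _
    (fun i => (s * v i)%:C + ii * ((1 - b) * e i + b * u' i)%:C)) => [| |i] //.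
    by apply: mmap_tube_neq0; apply: in_cone_segment.
  by rewrite !rmorphD !rmorphM; ring.
rewrite (eq_mmap _ _ _ (real_complex R) _
    (fun i => 1%:C * ii * (e i)%:C + s * (v i)%:C)) => [| |i] //.
  by apply: mmap_e_cone_neq0.
by rewrite rmorph1; ring.
Qed.

(** A small multiple of [e] is taken from [u] and given to [s v], which puts both summands in the
    open cone. *)
Lemma in_coneD_closed u v s : in_cone u -> hcone_closed h e v -> 0 <= s ->
  in_cone (fun i => u i + s * v i).
Proof.
move=> Hu /hcone_closedP Hv s0; have [->|sn0] := eqVneq s 0.
  move=> t t0; rewrite (meval_eq _ (_ : _ =1 fun i => t * e i + u i)) ?Hu // => i.
  by ring.
have [a a0 Hua] := in_cone_subl _ Hu.
have Hva : in_cone (fun i => s * v i + a * e i).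
  move=> t t0.
  rewrite (meval_eq _ (_ : _ =1 fun i => s * ((t + a) / s * e i + v i))).
    rewrite mevalZr mulf_neq0 ?expf_neq0 //; apply: Hv.
    by rewrite divr_gt0 //; [lra | rewrite lt_neqAle eq_sym sn0].
  by move=> i; field.
move=> t t0; have := in_coneD _ _ Hua Hva t t0.
by rewrite (meval_eq _ (_ : _ =1 fun i => t * e i + (u i + s * v i))) // => i; ring.
Qed.

End Garding.

(** * The bracket polynomial: homogeneity and non-vanishing on a tube *)

Section Bracket.
Context {R : realType} {n m : nat} (h : {mpoly R[n]}) (v : 'I_m -> 'I_n -> R).
Local Notation C := R[i].
Local Notation "x %:C" := (real_complex R x) : ring_scope.
Local Notation Im := (@complex.Im R).
Local Notation ii := (Complex 0 1 : C).
Implicit Types (p : {mpoly R[n + m]}).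

Let hbr_seq (l : seq 'I_m) : {mpoly R[n + m]} :=
  foldr (fun j p => p - 'X_(rshift n j) * @Dx R n m (v j) p) (@lift_x R n m h) l.

Lemma mmap_Dx (T : comNzRingType) (f : {rmorphism R -> T}) (w : 'I_(n + m) -> T)
    (u : 'I_n -> R) p :
  mmap f w (Dx u p) = \sum_(k < n) f (u k) * mmap f w (mderiv (lshift m k) p).
Proof.
by rewrite /Dx rmorph_sum; apply: eq_bigr => k _; rewrite /= mmapZ.
Qed.

Lemma mmap_lift_x (T : comNzRingType) (f : {rmorphism R -> T}) (w : 'I_(n + m) -> T) :
  mmap f w (@lift_x R n m h) = mmap f (fun k => w (lshift m k)) h.
Proof.
rewrite /lift_x /comp_mpoly rmorph_mmap; apply: eq_mmap => i /=.
  by rewrite mmapC.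
by rewrite tnth_mktuple mmapX mmap1U.
Qed.

Lemma mpolyX_mul_mderiv_homog (i j : 'I_(n + m)) p d :
  p \is d.-homog -> 'X_j * mderiv i p \is d.-homog.
Proof.
move=> /dhomogP hp; rewrite (mpolyE p) raddf_sum mulr_sumr big_seq.
apply: rpred_sum => /= q /hp qd; rewrite mderivZ mderivX -!scalerAr.
(* Subtraction of exponents is truncated, so a monomial free of the variable [i] is treated apart;
   its derivative vanishes. *)
apply/rpredZ; have [->|q0] := eqVneq (q i) 0%N.
  by rewrite scale0r rpred0.
apply/rpredZ; rewrite -mpolyXD dhomogX /= mdegD mdeg1.
have Uq : (U_(i) <= q)%MM by rewrite lep1mP.
have : mdeg (q - U_(i) + U_(i))%MM = d by rewrite submK.
by rewrite mdegD mdeg1 addnC => ->.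
Qed.

Lemma lift_x_homog d : h \is d.-homog -> @lift_x R n m h \is d.-homog.
Proof.
move=> /dhomogP hp; rewrite /lift_x comp_mpolyEX big_seq.
apply: rpred_sum => /= q /hp qd; apply/rpredZ; rewrite comp_mpolyX.
have <- : (\sum_(i < n) q i)%N = d by rewrite -mdegE.
apply: (big_ind2 (fun p d => p \is d.-homog)) => [|p1 d1 p2 d2|i _].
- exact: dhomog1.
- exact: dhomogM.
- rewrite tnth_mktuple -[X in X.-homog]mul1n; apply: dhomogMn.
  by rewrite dhomogX /= mdeg1.
Qed.

(** The factor [y_j] restores the degree that [D_{v_j}] removes. *)
Lemma hbr_homog d : h \is d.-homog -> hbr h v \is d.-homog.
Proof.
move=> hd; rewrite /hbr; elim: (enum _) => [|j l IH] /=; first exact: lift_x_homog.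
apply: rpredB => //; rewrite /Dx mulr_sumr; apply: rpred_sum => k _.
by rewrite -scalerAr; apply/rpredZ/mpolyX_mul_mderiv_homog.
Qed.

Lemma meval_hbr_joinv0 (e : 'I_n -> R) : (hbr h v).@[joinv e (fun=> 0)] = h.@[e].
Proof.
rewrite /hbr; elim: (enum _) => [|j l IH] /=.
  rewrite /meval mmap_lift_x; apply: eq_mmap => // k.
  by rewrite /joinv (unsplitK (inl k)).
by rewrite mevalB mevalM mevalXU IH /joinv (unsplitK (inr j)) mul0r subr0.
Qed.

Context (e : 'I_n -> R) (d : nat) (h_homog : h \is d.-homog) (he : h.@[e] != 0).
Context (h_real_rooted : forall (x : 'I_n -> R) (z : C), Im z != 0 ->
  mmap (real_complex R) (fun i => (x i)%:C + z * (e i)%:C) h != 0).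
Context (v_closed : forall j, hcone_closed h e (v j)).

(* Restricting to the complex line through [w] in direction [(v_j, 0)], the operator
   [1 - y_j D_{v_j}] becomes [q |-> q - y_j q'] at [0]. *)
Lemma hbr_tube_neq0 (w : 'I_(n + m) -> C) :
  in_cone h e (fun k => Im (w (lshift m k))) ->
  (forall j, Im (w (rshift n j)) <= 0) ->
  mmap (real_complex R) w (hbr h v) != 0.
Proof.
rewrite /hbr -/(hbr_seq _); elim: (enum _) w => [|j l IH] w Hx Hy /=.
  rewrite mmap_lift_x.
  rewrite (eq_mmap _ _ _ (real_complex R) _ (fun k =>
    (complex.Re (w (lshift m k)))%:C + ii * (Im (w (lshift m k)))%:C)) //.
    exact: (mmap_tube_neq0 h e d h_homog he h_real_rooted _ _ Hx).
  by move=> k; rewrite -complexE.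
pose V : 'I_(n + m) -> C := fun i => (joinv (v j) (fun _ : 'I_m => 0) i)%:C.
pose q : {poly C} := mmap (polyC \o real_complex R)
  (fun i => (w i)%:P + 'X * (V i)%:P) (hbr_seq l).
have qE s : q.[s] = mmap (real_complex R) (fun i => w i + s * V i) (hbr_seq l).
  rewrite /q -/(horner_eval s _) rmorph_mmap.
  by apply: eq_mmap => i; rewrite /= /horner_eval !hornerE.
have q0 : q.[0] = mmap (real_complex R) w (hbr_seq l).
  by rewrite qE; apply: eq_mmap => // i; rewrite mul0r addr0.
have dq0 : (q^`()).[0] = mmap (real_complex R) w (Dx (v j) (hbr_seq l)).
  rewrite /q deriv_mmap mmap_Dx horner_sum big_split_ord /=.
  rewrite [X in _ + X]big1 ?addr0 => [|k _]; last first.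
    rewrite /V /joinv (unsplitK (inr k)) rmorph0 mulr0 addr0 derivC.
    by rewrite mulr0 hornerC.
  apply: eq_bigr => k _.
  rewrite derivD derivC add0r derivM derivX derivC mulr0 addr0 mul1r.
  rewrite hornerM hornerC mulrC /V /joinv (unsplitK (inl k)); congr (_ * _).
  rewrite -/(horner_eval 0 _) rmorph_mmap.
  by apply: eq_mmap => i; rewrite /= /horner_eval !hornerE ?mul0r ?addr0.
rewrite rmorphB rmorphM /= mmapX mmap1U -q0 -dq0.
(* The induction hypothesis applies at every [w + s V] with [Im s >= 0]: the imaginary part in [x]
   gains [Im s] times [v_j] and stays in the cone, while the [y] coordinates do not move. *)
apply: upper_free_sub_deriv => // s s0; rewrite qE; apply: IH => [|k].
  have := in_coneD_closed h e d h_homog he h_real_rooted _ _ _ Hx (v_closed j) s0.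
  congr in_cone; apply: funext => k.
  rewrite /V /joinv (unsplitK (inl k)).
  by case: (w _) s {s0} => [a b] [a' b'] /=; ring.
by rewrite /V /joinv (unsplitK (inr k)) rmorph0 mulr0 addr0.
Qed.

End Bracket.

(** * Hyperbolicity of the bracket and the cone inclusion, both from non-vanishing on the tube *)

Theorem theorem3p3 (R : realType) (n m : nat) (h : {mpoly R[n]}) (e : 'I_n -> R)
    (v : 'I_m -> 'I_n -> R) :
  hyperbolic h e ->
  (forall j : 'I_m, hcone_closed h e (v j)) ->
  hyperbolic (hbr h v) (joinv e (fun _ : 'I_m => 0)) /\
  (forall (x : 'I_n -> R) (y : 'I_m -> R),
     hcone_open h e x -> (forall j : 'I_m, y j <= 0) ->
     hcone_open (hbr h v) (joinv e (fun _ : 'I_m => 0)) (joinv x y)).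
Proof.
move=> [[d h_homog] he h_real] v_closed.
have h_real_rooted (x : 'I_n -> R) (z : R[i]) : complex.Im z != 0 ->
    mmap (real_complex R) (fun i => real_complex R (x i) + z * real_complex R (e i)) h != 0.
  move=> zI; apply: contraNneq zI => E.
  have : real_complex R (complex.Im z) = 0.
    rewrite complexIm; apply: (h_real (fun i => - x i)).
    apply/rootP; rewrite restr_line_complex_horner -E.
    by apply: eq_mmap => // i; rewrite rmorphN opprK addrC.
  by case=> ->.
have Hd : hbr h v \is d.-homog by exact: hbr_homog.
have tube := hbr_tube_neq0 h v e d h_homog he h_real_rooted v_closed.
have joinl (x : 'I_n -> R) (y : 'I_m -> R) k : joinv x y (lshift m k) = x k.
  by rewrite /joinv (unsplitK (inl k)).
have joinr (x : 'I_n -> R) (y : 'I_m -> R) j : joinv x y (rshift n j) = y j.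
  by rewrite /joinv (unsplitK (inr j)).
split.
  split; first by exists d.
    by rewrite meval_hbr_joinv0.
  move=> x z /rootP; rewrite restr_line_complex_horner.
  set w := (fun i => _) => E.
  suff : complex.Im z = 0 by rewrite -complexIm => ->.
  (* The imaginary part of [w] is [Im z] times [(e, 0)], so [w] is in the tube if [Im z > 0], and
     [- w] is if [Im z < 0]; homogeneity relates the two values. *)
  have wl k : complex.Im (w (lshift m k)) = complex.Im z * e k.
    by rewrite /w joinl; case: (z) => a b /=; ring.
  have wr j : complex.Im (w (rshift n j)) = 0.
    by rewrite /w joinr; case: (z) => a b /=; ring.
  have ImN (s : R[i]) : complex.Im (- s) = - complex.Im s by case: s.
  case: (ltgtP (complex.Im z) 0) => // zI; exfalso.
    have /eqP[] : mmap (real_complex R) (fun i => -1 * w i) (hbr h v) != 0.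
      apply: tube => [|j]; last by rewrite mulN1r ImN wr oppr0.
      have := in_cone_e h e d h_homog he (- complex.Im z).
      rewrite oppr_gt0 => /(_ zI); congr in_cone; apply: funext => k.
      by rewrite mulN1r ImN wl mulNr.
    by rewrite (mmap_homog _ _ _ _ _ _ _ Hd) E mulr0.
  have /eqP[] : mmap (real_complex R) w (hbr h v) != 0; last exact: E.
  apply: tube => [|j]; last by rewrite wr.
  have := in_cone_e h e d h_homog he _ zI.
  by congr in_cone; apply: funext => k; rewrite wl.
move=> x y /(hcone_openP h e d h_homog) Hx Hy t /rootP.
rewrite restr_line_horner => E; rewrite ltNge; apply/negP => t0.
(* Multiplying by [-i] moves the real zero [t(e,0) - (x,y)] into the tube over
   [(x - t e, y)]. *)
have /eqP[] : mmap (real_complex R) (fun i => Complex 0 (-1) *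
   real_complex R (t * joinv e (fun=> 0) i - joinv x y i)) (hbr h v) != 0.
  apply: tube => [|j].
    have := in_cone_addl h e _ (- t) Hx; rewrite oppr_ge0 => /(_ t0).
    congr in_cone; apply: funext => k; rewrite !joinl /=; ring.
  by rewrite !joinr /=; have := Hy j; lra.
by rewrite (mmap_homog _ _ _ _ _ _ _ Hd) (mmap_real (hbr h v)) E rmorph0 mulr0.
Qed.
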